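(* Let the recursive multigrid coarse grid correction algorithm (described in the context) be applied on a sequence of grids $j=1,\dots,m$ ($m\geqslant 2$) such that grid $j+1$ is coarser than grid $j$ for all $j=1,\dots,m-1$. Let $A_j\in\mathbb{R}^{n_j\times n_j}$, $j=1,\dots,m$ (with $A_1=A$, $n_1=N$), be discretizations of a certain PDE operator on grid $j$ which satisfy, with constants $\omega_j\geqslant 0$, $$\frac{(\frac12(A_j+A_j^T)x,x)}{(x,x)}\geqslant\omega_j\quad\text{for all } x\in\mathbb{R}^{n_j},\ x\neq 0,$$ and let $\bar\omega=\min_{j=1,\dots,m}\omega_j$. Furthermore, let $Q_j\in\mathbb{R}^{n_j\times n_{j+1}}$, $j=1,\dots,m-1$, be linear prolongation operators from grid $j+1$ to grid $j$, let $v,g\in\mathbb{R}^N$ be not simultaneously zero, and let $y_{\mathrm{ex}}(t)$ be the exact solution of the initial-value problem $y'(t)=-Ay(t)+g$, $y(0)=v$. If the tolerances in the $\varphi$ matrix function evaluations (steps 1 and 2 of the algorithm) are chosen such that $$\max_{s\in[0,t]}\|\tilde r_m(s)\|\leqslant\beta\,\mathtt{tol},\qquad \max_{s\in[0,t]}\|\hat r_j(s)\|\leqslant\beta\,\mathtt{tol},\quad j=1,\dots,m-1,$$ where $\beta=\|g-Av\|$, and $\tilde r_m(s)$ and $\hat r_j(s)$ are the residuals of the solvers employed respectively at step 1 on grid $m$ and at step 2 on grid $j$, then for the solution $y_{\mathrm{mg}}(t)$ of the multigrid algorithm it holds, for any $t\geqslant 0$, $$\|y_{\mathrm{ex}}(t)-y_{\mathrm{mg}}(t)\|\leqslant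 \sum_{j=1}^{m-1}\left(\prod_{i=1}^{j-1}\|Q_i\|\right) t\left\|\bigl(\varphi(-tA_j)Q_j-Q_j\varphi(-tA_{j+1})\bigr)\tilde g_{j+1}\right\| + t\varphi(-t\bar\omega)\,\beta\,\mathtt{tol}\sum_{j=1}^{m}\prod_{i=1}^{j-1}\|Q_i\|,$$ where $\tilde g_1=g-Av$ and $\tilde g_{j+1}=Q_j^T\tilde g_j$ for $j=1,\dots,m-1$ (empty products equal $1$).
   Context: $(\cdot,\cdot)$ is the Euclidean inner product and $\|\cdot\|$ is the Euclidean vector norm or the corresponding operator norm. The function $\varphi$ is the entire function $\varphi(z)=(e^z-1)/z$ for $z\in\mathbb{C}\setminus\{0\}$, $\varphi(0)=1$, and $\varphi(-tA)$ denotes the corresponding matrix function. The exact solution is $y_{\mathrm{ex}}(t)=v+t\varphi(-tA)(g-Av)$. Grid $1$ is the finest and grid $m$ the coarsest ($n_1>n_2>\dots>n_m$); $Q_j^T$ is the restriction operator from grid $j$ to grid $j+1$; $\mathtt{tol}>0$ is a given tolerance. Multigrid coarse grid correction algorithm, for given $A=A_1,v,g,t,\mathtt{tol}$ (recursion written out over the grids): Splitting. Set $\tilde g_1=g-Av$ and, for $j=1,\dots,m-1$, $\tilde g_{j+1}=Q_j^T\tilde g_j$ and $\hat g_j=\tilde g_j-Q_j\tilde g_{j+1}$. Step 1 (coarsest grid $m$). Compute an approximation $\tilde y_m(s)\approx s\varphi(-sA_m)\tilde g_m$, $s\in[0,t]$: a continuously differentiable function $\tilde y_m:[0,t]\to\mathbb{R}^{n_m}$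 with $\tilde y_m(0)=0$. Its residual is $\tilde r_m(s)=-A_m\tilde y_m(s)-\tilde y_m'(s)+\tilde g_m$. Set $y_{\mathrm{mg}}^{(m)}(t)=\tilde y_m(t)$. Step 2 (grids $j=m-1,\dots,1$). Compute an approximation $\hat y_j(s)\approx s\varphi(-sA_j)\hat g_j$, $s\in[0,t]$: a continuously differentiable function $\hat y_j:[0,t]\to\mathbb{R}^{n_j}$ with $\hat y_j(0)=0$. Its residual is $\hat r_j(s)=-A_j\hat y_j(s)-\hat y_j'(s)+\hat g_j$. Step 3. For $j=m-1,\dots,1$ set $y_{\mathrm{mg}}^{(j)}(t)=\hat y_j(t)+Q_j\,y_{\mathrm{mg}}^{(j+1)}(t)$. The output of the algorithm is $y_{\mathrm{mg}}(t)=v+y_{\mathrm{mg}}^{(1)}(t)$. *)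

(* Defs.v *)
From HB Require Import structures.
From mathcomp Require Import all_boot all_order all_algebra.
From mathcomp Require Import all_classical all_reals all_analysis.
Import Order.TTheory GRing.Theory Num.Theory.
Import numFieldNormedType.Exports.

Set Implicit Arguments.
Unset Strict Implicit.
Unset Printing Implicit Defensive.

Local Open Scope classical_set_scope.
Local Open Scope ring_scope.

Section Euclidean.
Context {R : realType}.

Definition dot n (x y : 'cV[R]_n) : R := \sum_(i < n) x i 0 * y i 0.

(* The library norm `|x| on matrices is the max norm, hence the Euclidean
   versions; limits and derivatives below use the library topology, which is
   the same as the Euclidean one in finite dimension. *)
Definition norm2 n (x : 'cV[R]_n) : R := Num.sqrt (dot x x).

Definition opnorm2 p n (M : 'M[R]_(p, n)) : R :=
  sup [set norm2 (M *m x) | x in [set x : 'cV[R]_n | norm2 x <= 1]].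

End Euclidean.

Section Phi.
Context {R : realType}.

Definition phi (z : R) : R := if z == 0 then 1 else (expR z - 1) / z.

(* Taylor coefficients at 0 of the entire function phi; see phi_series. *)
Definition phi_coeff (k : nat) : R := (k.+1)`!%:R^-1.

Definition phi_mx n (M : 'M[R]_n) : 'M[R]_n :=
  limn (series (fun k => phi_coeff k *: M ^+ k)).

Lemma phi_series (z : R) : series (fun k => phi_coeff k * z ^+ k) @ \oo --> phi z.
Proof.
rewrite /phi; case: eqVneq => [->|z0].
  rewrite -(@cvg_shiftS _) /=.
  apply: (@cvg_trans _ ((fun=> 1 : R) @ \oo)); last exact: cvg_cst.
  apply: near_eq_cvg; apply: nearW => k /=.
  rewrite /series /= big_nat_recl//= expr0 mulr1 /phi_coeff invr1.
  by rewrite big1 ?addr0// => i _; rewrite expr0n mulr0.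
have cvgE : series (exp_coeff z) @ \oo --> expR z.
  exact: is_cvg_series_exp_coeff.
move: cvgE; rewrite -(@cvg_shiftS _) /= => cvgE.
have -> : series (fun k => phi_coeff k * z ^+ k) =
    (fun k => (series (exp_coeff z) k.+1 - 1) * z^-1).
  apply/funext => k; rewrite /series /= big_nat_recl//=.
  rewrite /exp_coeff /= expr0 fact0 divr1 addrAC subrr add0r mulr_suml.
  apply: eq_bigr => i _.
  by rewrite exprSr mulrAC mulrK ?unitfE// mulrC.
apply: cvgM; last exact: cvg_cst.
by apply: cvgB => //; exact: cvg_cst.
Qed.

End Phi.

Section Derivative.
Context {R : realType} {V : normedModType R}.
Implicit Types (D : set R) (y : R -> V) (s : R).

(* Difference quotients at s with the second point restricted to D, so that
   derivatives at an endpoint of the interval D are one-sided. *)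
Definition diff_quot y s (u : R) : V := (u - s)^-1 *: (y u - y s).

Definition derivable_within D y s : Prop :=
  cvg (diff_quot y s @ within D s^').

Definition derive_within D y s : V := lim (diff_quot y s @ within D s^').

Definition C1_on D y : Prop :=
  (forall s, D s -> derivable_within D y s) /\
  {within D, continuous (derive_within D y)}.

End Derivative.

Section Algorithm.
Context {R : realType}.

Definition solves_ivp n (A : 'M[R]_n) (v g : 'cV[R]_n) (y : R -> 'cV[R]_n) :=
  y 0 = v /\
  forall s : R, 0 <= s ->
    derivable_within `[0, +oo[ y s /\
    derive_within `[0, +oo[ y s = - (A *m y s) + g.

Definition residual t n (A : 'M[R]_n) (b : 'cV[R]_n) (y : R -> 'cV[R]_n)
    (s : R) : 'cV[R]_n :=
  - (A *m y s) - derive_within `[0, t] y s + b.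

(* Grids are numbered 1, ..., m; the families are indexed by nat and only
   their values in that range are constrained or used. *)
Record coarse_grid_correction (m : nat) (n : nat -> nat)
    (A : forall j, 'M[R]_(n j)) (Q : forall j, 'M[R]_(n j, n j.+1))
    (v g : 'cV[R]_(n 1%N)) (t : R)
    (gtilde ghat : forall j, 'cV[R]_(n j))
    (ytilde : R -> 'cV[R]_(n m)) (yhat : forall j, R -> 'cV[R]_(n j))
    (ymgj : forall j, 'cV[R]_(n j)) (ymg : 'cV[R]_(n 1%N)) : Prop :=
  CoarseGridCorrection {
    cgc_gtilde1 : gtilde 1%N = g - A 1%N *m v;
    cgc_gtildeS : forall j, (1 <= j < m)%N ->
      gtilde j.+1 = (Q j)^T *m gtilde j;
    cgc_ghat : forall j, (1 <= j < m)%N ->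
      ghat j = gtilde j - Q j *m gtilde j.+1;
    cgc_ytildeC1 : C1_on `[0, t] ytilde;
    cgc_ytilde0 : ytilde 0 = 0;
    cgc_yhatC1 : forall j, (1 <= j < m)%N -> C1_on `[0, t] (yhat j);
    cgc_yhat0 : forall j, (1 <= j < m)%N -> yhat j 0 = 0;
    cgc_ymgm : ymgj m = ytilde t;
    cgc_ymgj : forall j, (1 <= j < m)%N ->
      ymgj j = yhat j t + Q j *m ymgj j.+1;
    cgc_ymg : ymg = v + ymgj 1%N }.

End Algorithm.

(* Main.v *)
(* On each grid the function [s phi(-s A_j) b] solves [w' = - A_j w + b], [w 0 = 0],
   so its distance [E] to an approximate solution satisfies [E' = - A_j E + r],
   with [r] the residual. The lower bound [omegabar] on the symmetric part of
   [A_j] gives [|E|' <= - omegabar |E| + rho], hence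
   [|E t| <= t phi(- t omegabar) rho]; with [r = 0] this also identifies [yex t]
   with [v + t phi(-t A) (g - A v)]. Since [gtilde_j = ghat_j + Q_j gtilde_(j+1)],
   the error [e_j] of the recursion on grid [j] is at most the commutator term,
   plus [|Q_j| e_(j+1)], plus the solver error, and unrolling over the grids
   gives the estimate. *)
Require Import Defs.
From mathcomp Require Import all_boot all_order all_algebra.
From mathcomp Require Import all_classical all_reals all_analysis.
From mathcomp Require Import ring lra.
Import Order.TTheory GRing.Theory Num.Theory.
Import numFieldNormedType.Exports.

Local Open Scope classical_set_scope.
Local Open Scope ring_scope.

(** * Power series for the entries of [s phi(s M)] and their derivatives *)

Section PhiMatrix.
Context {R : realType}.

Lemma cvg_sum {I T : Type} (F : set_system T) {FF : Filter F} (r : seq I)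
    (u : I -> T -> R) (a : I -> R) :
  (forall i, u i k @[k --> F] --> a i) ->
  \sum_(i <- r) u i k @[k --> F] --> \sum_(i <- r) a i.
Proof.
by move=> ua; apply: cvg_big => //; exact: add_continuous.
Qed.

Lemma cvg_mx_coord {m n : nat} (T : Type) (F : set_system T) {FF : Filter F}
    (u : T -> 'M[R]_(m, n)) (M : 'M[R]_(m, n)) :
  (forall i j, u k i j @[k --> F] --> M i j) -> u k @[k --> F] --> M.
Proof.
move=> uM; apply/cvg_ballP => e e0.
have H : \forall k \near F, forall i j, ball (M i j) e (u k i j).
  by apply: filter_forall => i; apply: filter_forall => j; exact: cvg_ball.
by apply: filterS H => k uk; split.
Qed.

(* [exprZn] needs a nontrivial ring, hence a positive dimension. *)
Lemma expmxZ {n : nat} (s : R) (M : 'M[R]_n) k : (s *: M) ^+ k = s ^+ k *: M ^+ k.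
Proof.
elim: k => [|k IH]; first by rewrite !expr0 scale1r.
rewrite [in LHS]exprS IH [in RHS]exprS [in RHS]exprS.
by rewrite -[LHS]/((s *: M) *m (s ^+ k *: M ^+ k)) -scalemxAl -scalemxAr scalerA.
Qed.

(** The sum of the moduli of all entries dominates every absolute row sum, so each further factor
    [M] costs at most one factor of it. *)
Lemma expmx_coord_le {n : nat} (M : 'M[R]_n) k i j :
  `|(M ^+ k) i j| <= (\sum_i \sum_j `|M i j|) ^+ k.
Proof.
elim: k i j => [|k IH] i j.
  by rewrite !expr0 mxE; case: (i == j); rewrite ?normr1 ?normr0.
rewrite exprS mxE (le_trans (ler_norm_sum _ _ _))// exprS.
apply: (@le_trans _ _ (\sum_l `|M i l| * (\sum_i \sum_j `|M i j|) ^+ k)).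
  by apply: ler_sum => l _; rewrite normrM ler_wpM2l.
rewrite -mulr_suml ler_wpM2r// ?exprn_ge0//.
  by apply: sumr_ge0 => *; exact: sumr_ge0.
rewrite [leRHS](bigD1 i)//= lerDl.
by apply: sumr_ge0 => *; exact: sumr_ge0.
Qed.

(** Comparison with the exponential series at [K * |s|]. *)
Lemma is_cvg_pseries_fact (c : nat -> R) (K s : R) :
  (forall k : nat, `|c k| <= K ^+ k / (k`!)%:R) -> cvgn (pseries c s).
Proof.
move=> cK; apply: normed_cvg.
have le k : `|c k * s ^+ k| <= exp_coeff (K * `|s|) k.
  by rewrite normrM normrX /exp_coeff/= exprMn mulrAC ler_wpM2r// exprn_ge0.
apply: (@series_le_cvg _ _ (exp_coeff (K * `|s|))) => //.
- by move=> k; exact: normr_ge0.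
- by move=> k; apply: (le_trans _ (le k)); exact: normr_ge0.
- exact: is_cvg_series_exp_coeff.
Qed.

(* The entries of [s phi(s M)] as power series in [s]. *)
Definition xphi_coeff {n : nat} (M : 'M[R]_n) i j (k : nat) : R :=
  if k is l.+1 then (M ^+ l) i j / k`!%:R else 0.

Lemma pseries_diffs_xphi {n : nat} (M : 'M[R]_n) i j :
  pseries_diffs (xphi_coeff M i j) = fun k => (M ^+ k) i j / k`!%:R.
Proof.
by apply/funext => k; rewrite /pseries_diffs /= factS natrM invfM mulrCA mulVKf.
Qed.

(** The summand 1 makes powers of [growth M] nondecreasing in the exponent; this absorbs the index
    shift in [xphi_coeff], where [M ^+ l] stands at degree [l.+1]. *)
Let growth {n : nat} (M : 'M[R]_n) := 1 + \sum_i \sum_j `|M i j|.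

Let growth_ge1 {n : nat} (M : 'M[R]_n) : 1 <= growth M.
Proof. by rewrite lerDl; apply: sumr_ge0 => *; exact: sumr_ge0. Qed.

Let expmx_growth {n : nat} (M : 'M[R]_n) k i j : `|(M ^+ k) i j| <= growth M ^+ k.
Proof.
apply: (le_trans (expmx_coord_le _ _ _ _)).
have S0 : 0 <= \sum_i \sum_j `|M i j|.
  by apply: sumr_ge0 => *; exact: sumr_ge0.
by rewrite lerXn2r ?nnegrE ?lerDr// addr_ge0.
Qed.

Lemma is_cvg_xphi {n : nat} (M : 'M[R]_n) i j s :
  cvgn (pseries (xphi_coeff M i j) s).
Proof.
apply: (is_cvg_pseries_fact _ (growth M)) => -[|k] /=.
  by rewrite normr0 expr0 fact0 divr1.
rewrite normrM normfV normr_nat ler_wpM2r// (le_trans (expmx_growth _ _ _ _))//.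
by rewrite ler_weXn2l.
Qed.

Lemma is_cvg_expmx {n : nat} (M : 'M[R]_n) i j s :
  cvgn (pseries (fun k => (M ^+ k) i j / k`!%:R) s).
Proof.
apply: (is_cvg_pseries_fact _ (growth M)) => k /=.
by rewrite normrM normfV normr_nat ler_wpM2r// (le_trans (expmx_growth _ _ _ _)).
Qed.

(** The formal derivative of the series of [exp(s M)] is [M] times that series, hence entrywise a
    finite combination of convergent series. *)
Lemma is_cvg_expmx_diffs {n : nat} (M : 'M[R]_n) i j s :
  cvgn (pseries (pseries_diffs (fun k => (M ^+ k) i j / k`!%:R)) s).
Proof.
have -> : pseries_diffs (fun k => (M ^+ k) i j / k`!%:R) =
          fun k => (M ^+ k.+1) i j / k`!%:R.
  by apply/funext => k; rewrite /pseries_diffs factS natrM invfM mulrCA mulVKf.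
have -> : pseries (fun k => (M ^+ k.+1) i j / k`!%:R) s =
    (fun N => \sum_l M i l * pseries (fun k => (M ^+ k) l j / k`!%:R) s N).
  apply/funext => N; rewrite /pseries /series /=.
  under [RHS]eq_bigr do rewrite mulr_sumr.
  rewrite exchange_big/=; apply: eq_bigr => k _.
  rewrite exprS mxE !mulr_suml; apply: eq_bigr => l _.
  by rewrite !mulrA.
apply/cvg_ex; eexists; apply: cvg_sum => l.
by apply: cvgM; [exact: cvg_cst|exact: is_cvg_expmx].
Qed.

(** [phi_mx] is a limit of matrices, so the matrix series must first be shown to converge. Its
    entries are the series of [xphi_coeff] at 1, shifted by one because their constant term is 0. *)
Lemma phi_mx_cvg_coord {n : nat} (M : 'M[R]_n) i j :
  series (fun k => phi_coeff k *: M ^+ k) k i j @[k --> \oo] --> phi_mx M i j.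
Proof.
have cvgc i' j' : cvgn (fun N => series (fun k => phi_coeff k *: M ^+ k) N i' j').
  have /cvg_ex[l] := is_cvg_xphi M i' j' 1.
  rewrite -cvg_shiftS => cl; apply/cvg_ex; exists l.
  rewrite (_ : (fun _ => _) = (fun N => pseries (xphi_coeff M i' j') 1 N.+1))//.
  apply/funext => N; rewrite /pseries /series/= summxE big_nat_recl//= mul0r add0r.
  by apply: eq_bigr => k _; rewrite mxE expr1n mulr1 mulrC.
have : cvgn (series (fun k => phi_coeff k *: M ^+ k)).
  apply/cvg_ex.
  exists (\matrix_(i, j) limn (fun N => series (fun k => phi_coeff k *: M ^+ k) N i j)).
  by apply: cvg_mx_coord => i' j'; rewrite mxE; exact: cvgc.
move=> cM; apply: (cvg_comp _ (fun N : 'M[R]_n => N i j) cM).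
exact: coord_continuous.
Qed.

Lemma phi_mxE {n : nat} (M : 'M[R]_n) s i j :
  limn (pseries (xphi_coeff M i j) s) = s * phi_mx (s *: M) i j.
Proof.
apply: cvg_lim => //; rewrite -cvg_shiftS /=.
rewrite (_ : (fun _ => _) =
    (fun N => s * series (fun k => phi_coeff k *: (s *: M) ^+ k) N i j)).
  by apply: cvgM; [exact: cvg_cst|exact: phi_mx_cvg_coord].
apply/funext => N; rewrite /pseries /series/= summxE big_nat_recl//= mul0r add0r.
rewrite mulr_sumr; apply: eq_bigr => k _.
by rewrite expmxZ !mxE exprS /phi_coeff; ring.
Qed.

(** Termwise differentiation of [W(s) = s phi(s M)] gives [exp(s M)], which equals [1 + M W(s)];
    this is the differential equation satisfied by [W]. *)
Lemma is_derive_phi_mx {n : nat} (M : 'M[R]_n) i j (s : R) :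
  is_derive s (1 : R) (fun s => s * phi_mx (s *: M) i j)
    ((1%:M + s *: (M *m phi_mx (s *: M))) i j).
Proof.
rewrite (_ : (fun _ => _) = (fun s => limn (pseries (xphi_coeff M i j) s))); last first.
  by apply/funext => x; rewrite phi_mxE.
have -> : (1%:M + s *: (M *m phi_mx (s *: M))) i j =
    limn (pseries (pseries_diffs (xphi_coeff M i j)) s).
  rewrite pseries_diffs_xphi; apply/esym/cvg_lim => //; rewrite -cvg_shiftS /=.
  (* The degree 0 term of [exp(s M)] is split off, and one factor [M] is taken out of every later
     term. *)
  rewrite (_ : (fun _ => _) = (fun N => (i == j)%:R +
      \sum_l M i l * pseries (xphi_coeff M l j) s N.+1)).
    rewrite !mxE; apply: cvgD; first exact: cvg_cst.
    rewrite mulr_sumr; apply: cvg_sum => l.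
    rewrite mulrCA; apply: cvgM; first exact: cvg_cst.
    by rewrite -phi_mxE cvg_shiftS; exact: is_cvg_xphi.
  apply/funext => N; rewrite /pseries /series /= big_nat_recl//=.
  rewrite expr0 mxE fact0 invr1 !mulr1; congr (_ + _).
  under [RHS]eq_bigr do rewrite big_nat_recl//= mul0r add0r mulr_sumr.
  rewrite exchange_big/=; apply: eq_bigr => k _.
  rewrite exprS mxE !mulr_suml; apply: eq_bigr => l _.
  by rewrite !mulrA.
(* Termwise differentiation at [s] asks for convergence of the series and of its first two formal
   derivatives at some point of modulus above [|s|]. *)
apply: (@pseries_snd_diffs _ _ (`|s| + 1)).
- exact: is_cvg_xphi.
- by rewrite pseries_diffs_xphi; exact: is_cvg_expmx.
- by rewrite pseries_diffs_xphi; exact: is_cvg_expmx_diffs.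
- by rewrite [ltRHS]ger0_norm ?addr_ge0// ltrDl.
Qed.

End PhiMatrix.

(** * Euclidean inner product, vector norm and operator norm *)

Section Euclidean.
Context {R : realType}.

Lemma dotC {n : nat} (x y : 'cV[R]_n) : dot x y = dot y x.
Proof. by apply: eq_bigr => i _; rewrite mulrC. Qed.

Lemma dotDl {n : nat} (x y z : 'cV[R]_n) : dot (x + y) z = dot x z + dot y z.
Proof. by rewrite -big_split; apply: eq_bigr => i _; rewrite mxE mulrDl. Qed.

Lemma dotZl {n : nat} a (x y : 'cV[R]_n) : dot (a *: x) y = a * dot x y.
Proof. by rewrite mulr_sumr; apply: eq_bigr => i _; rewrite mxE mulrA. Qed.

Lemma dotDr {n : nat} (x y z : 'cV[R]_n) : dot z (x + y) = dot z x + dot z y.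
Proof. by rewrite dotC dotDl !(dotC z). Qed.

Lemma dotZr {n : nat} a (x y : 'cV[R]_n) : dot y (a *: x) = a * dot y x.
Proof. by rewrite dotC dotZl dotC. Qed.

Lemma dot_trmx {m n : nat} (M : 'M[R]_(m, n)) x y : dot (M^T *m x) y = dot x (M *m y).
Proof.
rewrite /dot; under eq_bigr do rewrite mxE mulr_suml.
rewrite exchange_big/=; apply: eq_bigr => i _.
rewrite mxE mulr_sumr; apply: eq_bigr => j _.
by rewrite mxE; ring.
Qed.

Lemma dot_ge0 {n : nat} (x : 'cV[R]_n) : 0 <= dot x x.
Proof. by apply: sumr_ge0 => i _; rewrite -expr2 sqr_ge0. Qed.

Lemma sqr_coord_le_dot {n : nat} (x : 'cV[R]_n) i : x i 0 ^+ 2 <= dot x x.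
Proof.
rewrite /dot (bigD1 i)//= expr2 lerDl.
by apply: sumr_ge0 => j _; rewrite -expr2 sqr_ge0.
Qed.

Lemma dot_eq0 {n : nat} (x : 'cV[R]_n) : (dot x x == 0) = (x == 0).
Proof.
apply/eqP/eqP => [x0|->]; last by rewrite /dot big1// => i _; rewrite mxE mul0r.
apply/matrixP => i j; rewrite (ord1 j) mxE; apply/eqP; rewrite -sqrf_eq0.
by rewrite eq_le sqr_ge0 andbT -x0 sqr_coord_le_dot.
Qed.

Lemma norm2_ge0 {n : nat} (x : 'cV[R]_n) : 0 <= norm2 x.
Proof. exact: sqrtr_ge0. Qed.

Lemma sqr_norm2 {n : nat} (x : 'cV[R]_n) : norm2 x ^+ 2 = dot x x.
Proof. by rewrite sqr_sqrtr// dot_ge0. Qed.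

Lemma norm2_eq0 {n : nat} (x : 'cV[R]_n) : (norm2 x == 0) = (x == 0).
Proof. by rewrite -sqrf_eq0 sqr_norm2 dot_eq0. Qed.

Lemma norm20 {n : nat} : norm2 (0 : 'cV[R]_n) = 0.
Proof. by apply/eqP; rewrite norm2_eq0. Qed.

Lemma norm2Z {n : nat} a (x : 'cV[R]_n) : norm2 (a *: x) = `|a| * norm2 x.
Proof. by rewrite /norm2 dotZl dotZr mulrA -expr2 sqrtrM ?sqr_ge0// sqrtr_sqr. Qed.

Lemma cauchy_schwarz {n : nat} (x y : 'cV[R]_n) : dot x y <= norm2 x * norm2 y.
Proof.
have [->|y0] := eqVneq y 0.
  by rewrite norm20 mulr0 /dot big1// => i _; rewrite mxE mulr0.
have b0 : 0 < dot y y by rewrite lt_neqAle dot_ge0 andbT eq_sym dot_eq0.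
(* This square equals [(y,y) ((x,x)(y,y) - (x,y)^2)], and [(y,y)] is positive. *)
have := dot_ge0 (dot y y *: x + (- dot x y) *: y).
rewrite !(dotDl, dotDr, dotZl, dotZr) (dotC y x) => h.
have {}h : 0 <= dot y y * (dot x x * dot y y - dot x y ^+ 2).
  by congr (_ <= _): h; ring.
rewrite pmulr_rge0// subr_ge0 in h.
rewrite (le_trans (ler_norm _))// -(@ler_pXn2r _ 2)// ?nnegrE ?mulr_ge0 ?norm2_ge0//.
by rewrite real_normK ?num_real// exprMn !sqr_norm2.
Qed.

Lemma norm2D {n : nat} (x y : 'cV[R]_n) : norm2 (x + y) <= norm2 x + norm2 y.
Proof.
rewrite -(@ler_pXn2r _ 2)// ?nnegrE ?addr_ge0 ?norm2_ge0//.
rewrite sqr_norm2 dotDl !dotDr (dotC y x) sqrrD !sqr_norm2.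
have := cauchy_schwarz x y; lra.
Qed.

(** The supremum in [opnorm2] is meaningful only for a bounded set. Coordinates of a vector in the
    unit ball have modulus at most 1, so each coordinate of [M x] is bounded by an absolute row
    sum. *)
Lemma opnorm2_has_ubound {p n : nat} (M : 'M[R]_(p, n)) :
  has_ubound [set norm2 (M *m x) | x in [set x : 'cV[R]_n | norm2 x <= 1]].
Proof.
exists (Num.sqrt (\sum_i (\sum_j `|M i j|) ^+ 2)) => _ [x /= x1 <-].
rewrite ler_wsqrtr//; apply: ler_sum => i _.
rewrite -expr2 -real_normK ?num_real// lerXn2r ?nnegrE//.
  by apply: sumr_ge0 => *.
rewrite mxE (le_trans (ler_norm_sum _ _ _))//; apply: ler_sum => j _.
rewrite normrM ler_piMr// -(@ler_pXn2r _ 2)// ?nnegrE//.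
rewrite real_normK ?num_real// (le_trans (sqr_coord_le_dot _ _))// -sqr_norm2.
by rewrite lerXn2r ?nnegrE ?norm2_ge0.
Qed.

Lemma opnorm2_ge0 {p n : nat} (M : 'M[R]_(p, n)) : 0 <= opnorm2 M.
Proof.
apply: ub_le_sup; first exact: opnorm2_has_ubound.
exists 0 => /=; first by rewrite norm20.
by rewrite mulmx0 norm20.
Qed.

Lemma opnorm2P {p n : nat} (M : 'M[R]_(p, n)) x :
  norm2 (M *m x) <= opnorm2 M * norm2 x.
Proof.
have [->|x0] := eqVneq x 0; first by rewrite mulmx0 !norm20 mulr0.
have nx : 0 < norm2 x by rewrite lt_neqAle norm2_ge0 andbT eq_sym norm2_eq0.
rewrite -ler_pdivrMr//; apply: ub_le_sup; first exact: opnorm2_has_ubound.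
exists ((norm2 x)^-1 *: x) => /=.
  by rewrite norm2Z ger0_norm ?invr_ge0 ?norm2_ge0// mulVf ?gt_eqF.
by rewrite -scalemxAr norm2Z ger0_norm ?invr_ge0 ?norm2_ge0// mulrC.
Qed.

End Euclidean.

(** * From derivatives relative to a set to continuity and ordinary derivatives *)

Section DeriveWithin.
Context {R : realType}.

Lemma diff_quot_coord_cvg {m n : nat} (D : set R) (y : R -> 'M[R]_(m, n)) s i j :
  derivable_within D y s ->
  (u - s)^-1 * (y u i j - y s i j) @[u --> within D s^'] -->
    derive_within D y s i j.
Proof.
move=> dy.
rewrite (_ : (fun _ => _) = (fun N : 'M[R]_(m, n) => N i j) \o diff_quot y s).
  apply: (cvg_comp (diff_quot y s) (fun N : 'M[R]_(m, n) => N i j) dy).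
  exact: coord_continuous.
by apply/funext => u; rewrite /diff_quot /= !mxE.
Qed.

Lemma continuous_within_coord {m n : nat} (D : set R)
    (y : R -> 'M[R]_(m, n)) i j :
  (forall s, D s -> derivable_within D y s) ->
  {within D, continuous (fun u => y u i j)}.
Proof.
move=> dy; apply/subspace_continuousP => s Ds.
have qc := diff_quot_coord_cvg D y s i j (dy _ Ds).
(* For [u != s] this expression is just [y u i j]; the point [u = s], absent from the punctured
   filter, is treated separately below. *)
have yc : y s i j + (u - s) * ((u - s)^-1 * (y u i j - y s i j))
    @[u --> within D s^'] --> y s i j + (s - s) * derive_within D y s i j.
  apply: cvgD; first exact: cvg_cst.
  apply: cvgM => //; apply: cvgB; last exact: cvg_cst.
  apply: cvg_within_filter; exact: nbhs_dnbhs.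
rewrite subrr mul0r addr0 in yc.
apply/cvgrPdist_lt => e e0.
move/cvgrPdist_lt : yc => /(_ e e0); rewrite !near_withinE => yc.
near=> u => Du; have [->|us] := eqVneq u s; first by rewrite subrr normr0.
have := near yc u; rewrite mulVKf ?subr_eq0// subrKC; apply => //.
Unshelve. all: by end_near. Qed.

Lemma derivable_within_is_derive {m n : nat} (D : set R)
    (y : R -> 'M[R]_(m, n)) s i j :
  nbhs s D -> derivable_within D y s ->
  is_derive s 1 (fun u => y u i j) (derive_within D y s i j).
Proof.
move=> Ds /(diff_quot_coord_cvg _ _ _ i j) dy.
(* Near [s] every point lies in [D], so the restriction to [D] is vacuous; it remains to translate
   the variable point [u] into an increment [h]. *)
have shift_s : h + s @[h --> (0 : R)^'] --> within D s^'.
  move=> B; rewrite /within /= => sB.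
  have {}sB : \forall u \near s, u != s -> B u.
    by apply: filterS2 Ds sB => u Du su us; exact: su us Du.
  move: sB; rewrite (near_shift 0 s); apply: filterS => h /= + h0.
  by rewrite subr0; apply; rewrite -subr_eq0 addrK.
have {}dy := cvg_comp _ _ shift_s dy.
have dyE : h^-1 *: (y (h *: 1 + s) i j - y s i j) @[h --> 0^'] -->
    derive_within D y s i j.
  rewrite (_ : (fun _ => _) = (fun u => (u - s)^-1 * (y u i j - y s i j)) \o
      (fun h => h + s))//.
  by apply/funext => h /=; rewrite addrK [_ *: 1]mulr1.
apply: DeriveDef; first by apply/cvg_ex; eexists; exact: dyE.
exact: cvg_lim dyE.
Qed.

End DeriveWithin.

(** * Energy estimate for the error in terms of the residual *)

Section Energy.
Context {R : realType}.

Lemma is_derive_expRM (omega s : R) :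
  is_derive s (1 : R) (fun u => expR (u * omega)) (omega * expR (s * omega)).
Proof.
have dlin : is_derive s (1 : R) (fun u => u * omega) omega.
  rewrite (_ : (fun _ => _) = omega \*: id); last first.
    by apply/funext => u /=; rewrite /GRing.scale/= mulrC.
  by apply: is_derive_eq; rewrite [_ *: _]mulr1.
rewrite mulrC.
exact: (@is_derive1_comp _ expR (fun u => u * omega) _ _ _ (is_derive_expR _) dlin).
Qed.

(** For [omega != 0] the function is [(exp(s omega) - 1) / omega]. It is the primitive of the
    integrating factor used in the energy estimate. *)
Lemma is_derive_xphi (omega s : R) :
  is_derive s (1 : R) (fun s => s * phi (s * omega)) (expR (s * omega)).
Proof.
have [->|omega0] := eqVneq omega 0.
  rewrite (_ : (fun _ => _) = id); first by rewrite mulr0 expR0; exact: is_derive_id.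
  by apply/funext => u; rewrite /phi mulr0 eqxx mulr1.
rewrite (_ : (fun _ => _) = omega^-1 \*: ((fun u => expR (u * omega)) - cst 1)).
  have dexp := is_derive_expRM omega s.
  by apply: is_derive_eq; rewrite subr0 /GRing.scale/= mulrA mulVf// mul1r.
apply/funext => u; rewrite -[RHS]/(omega^-1 * (expR (u * omega) - 1)).
rewrite /phi mulf_eq0 (negPf omega0) orbF.
case: eqVneq => [->|u0]; first by rewrite !mul0r expR0 subrr mulr0.
by field; rewrite u0 omega0.
Qed.

Lemma xphiN (omega t : R) :
  t * phi (- t * omega) = expR (- t * omega) * (t * phi (t * omega)).
Proof.
rewrite /phi mulNr oppr_eq0; case: eqVneq => [->|w0].
  by rewrite oppr0 expR0 !mul1r.
rewrite expRN; have := expR_gt0 (t * omega) => e0.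
have [t0 o0] : t != 0 /\ omega != 0 by move: w0; rewrite mulf_eq0 negb_or => /andP.
by field; rewrite t0 o0 gt_eqF.
Qed.

Lemma phi_ge0 (z : R) : 0 <= phi z.
Proof.
rewrite /phi; case: (ltrgt0P z) => [z0|z0|_]; rewrite ?ler01//.
  by rewrite divr_ge0 ?ltW// subr_gt0 expR_gt1.
by rewrite -mulrNN -invrN divr_ge0 ?oppr_ge0 ?ltW// subr_lt0 expR_lt1.
Qed.

(* The regularisation [eps] makes the norm differentiable where the error
   vanishes; it is removed in [energy_bound]. *)
Lemma energy_bound_eps {n : nat} (A : 'M[R]_n) (omega rho t eps : R)
    (E dE : R -> 'cV[R]_n) :
  0 <= omega -> 0 < t -> 0 < eps ->
  (forall x, omega * dot x x <= dot (A *m x) x) ->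
  E 0 = 0 ->
  (forall i, {within `[0, t], continuous (fun u => E u i 0)}) ->
  (forall s i, 0 < s < t -> is_derive s (1 : R) (fun u => E u i 0) (dE s i 0)) ->
  (forall s, 0 < s < t -> norm2 (dE s + A *m E s) <= rho) ->
  norm2 (E t) <= expR (- t * omega) * eps +
    (rho + omega * eps) * (t * phi (- t * omega)).
Proof.
move=> omega0 t0 eps0 coercive E0 Ec Ed Er.
(* [F] is the regularised norm and satisfies [F' <= - omega F + rho + omega eps]. Multiplying by
   [exp(s omega)] and subtracting the integral of the constant part gives [G], which is therefore
   nonincreasing. *)
pose D s := dot (E s) (E s) + eps ^+ 2.
pose F s := Num.sqrt (D s).
pose G s := expR (s * omega) * F s - (rho + omega * eps) * (s * phi (s * omega)).
have D0 s : 0 < D s by rewrite ltr_wpDl ?dot_ge0// exprn_gt0.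
have F0 s : 0 < F s by rewrite sqrtr_gt0.
have sqrF s : F s ^+ 2 = dot (E s) (E s) + eps ^+ 2 by rewrite sqr_sqrtr// ltW.
have epsF s : eps <= F s.
  by rewrite -(@ler_pXn2r _ 2)// ?nnegrE ?(ltW eps0) ?(ltW (F0 s))// sqrF lerDr dot_ge0.
have normF s : norm2 (E s) <= F s.
  by rewrite ler_wsqrtr// lerDl sqr_ge0.
have dD s : 0 < s < t -> is_derive s (1 : R) D (2 * dot (dE s) (E s)).
  move=> st.
  have -> : D = \sum_(i < n) ((fun u => E u i 0) * (fun u => E u i 0)) + cst (eps ^+ 2).
    by apply/funext => u; rewrite fctE fct_sumE.
  have dEi i := Ed s i st.
  apply: is_derive_eq.
  rewrite addr0 mulr_sumr; apply: eq_bigr => i _.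
  by rewrite /GRing.scale/=; ring.
have dexp s := is_derive_expRM omega s.
have dG s : 0 < s < t -> is_derive s (1 : R) G
    (expR (s * omega) * (omega * F s + dot (dE s) (E s) / F s - (rho + omega * eps))).
  move=> st; have dDs := dD s st.
  have dF : is_derive s (1 : R) F (dot (dE s) (E s) / F s).
    have dsqrt := is_derive1_sqrt (D0 s).
    rewrite (_ : _ / _ = (2 * Num.sqrt (D s))^-1 * (2 * dot (dE s) (E s))).
      exact: (@is_derive1_comp _ Num.sqrt D _ _ _ dsqrt dDs).
    by rewrite -/(F s); field; rewrite gt_eqF.
  have dH := is_derive_xphi omega s.
  rewrite (_ : G = (fun u => expR (u * omega)) * F -
      (rho + omega * eps) \*: (fun u => u * phi (u * omega)))//.
  by apply: is_derive_eq; rewrite /GRing.scale/=; ring.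
have dG0 s : 0 < s < t -> derive1 G s <= 0.
  move=> st; have dGs := dG s st; rewrite derive1E derive_val.
  rewrite pmulr_rle0 ?expR_gt0// -(pmulr_lle0 _ (F0 s)).
  have -> : (omega * F s + dot (dE s) (E s) / F s - (rho + omega * eps)) * F s =
      omega * F s ^+ 2 + dot (dE s) (E s) - (rho + omega * eps) * F s.
    by field; rewrite gt_eqF.
  (* Cauchy-Schwarz bounds the contribution of the residual [dE + A E], and coercivity that of
     [- A E]. *)
  have dotE : dot (dE s) (E s) <= rho * F s - omega * dot (E s) (E s).
    have -> : dE s = (dE s + A *m E s) + (-1) *: (A *m E s) by rewrite scaleN1r addrK.
    rewrite dotDl dotZl mulN1r lerB// (le_trans (cauchy_schwarz _ _))//.
    rewrite ler_pM ?norm2_ge0//; exact: Er.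
  (* As [(E,E) = F^2 - eps^2], coercivity leaves an excess [omega eps^2], absorbed through
     [eps <= F]; hence the summand [omega * eps] next to [rho]. *)
  have eF : omega * eps ^+ 2 <= omega * eps * F s.
    by rewrite expr2 -mulrA ler_wpM2l// ler_wpM2l// ltW.
  rewrite sqrF; lra.
have cexp : {within `[0, t], continuous (fun u => expR (u * omega))}.
  apply: continuous_subspaceT => u; apply: differentiable_continuous.
  by apply/derivable1_diffP; have [] := dexp u.
have cphi : {within `[0, t], continuous (fun u => u * phi (u * omega))}.
  apply: continuous_subspaceT => u; apply: differentiable_continuous.
  by apply/derivable1_diffP; have [] := is_derive_xphi omega u.
have cG : {within `[0, t], continuous G}.
  move=> s; have FF : Filter (nbhs_subspace (A := `[0, t]) s).
    exact: nbhs_subspace_filter.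
  apply: cvgB; last by apply: cvgM; [exact: cvg_cst|exact: cphi].
  apply: cvgM; first exact: cexp.
  apply: (@cvg_comp _ _ _ D Num.sqrt _ (nbhs (D s))); last exact: sqrt_continuous.
  apply: cvgD; last exact: cvg_cst.
  by apply: cvg_sum => i; apply: cvgM; exact: Ec.
(* The endpoints enter only through continuity, so interior derivatives suffice to compare [G t]
   with [G 0]. *)
have := @ler0_derive1_nincr _ G 0 t _ _ cG 0 t (lexx _) (ltW t0) (lexx _).
have -> : G 0 = eps.
  rewrite /G !mul0r expR0 mulr0 subr0 mul1r /F /D E0 /dot big1; last first.
    by move=> i _; rewrite mxE mul0r.
  by rewrite add0r sqrtr_sqr gtr0_norm.
move=> Gt.
apply: le_trans (normF t) _.
have {}Gt : G t <= eps.
  by apply: Gt => s; rewrite in_itv/= => st; [have [] := dG s st|exact: dG0].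
rewrite xphiN mulrCA -mulrDr mulNr expRN -ler_pdivrMl ?invr_gt0 ?expR_gt0//.
by rewrite invrK -lerBlDr.
Qed.

Lemma energy_bound {n : nat} (A : 'M[R]_n) (omega rho t : R)
    (E dE : R -> 'cV[R]_n) :
  0 <= omega -> 0 < t ->
  (forall x, omega * dot x x <= dot (A *m x) x) ->
  E 0 = 0 ->
  (forall i, {within `[0, t], continuous (fun u => E u i 0)}) ->
  (forall s i, 0 < s < t -> is_derive s (1 : R) (fun u => E u i 0) (dE s i 0)) ->
  (forall s, 0 < s < t -> norm2 (dE s + A *m E s) <= rho) ->
  norm2 (E t) <= t * phi (- t * omega) * rho.
Proof.
move=> omega0 t0 coercive E0 Ec Ed Er; apply/ler_addgt0Pr => e e0.
set x := t * phi (- t * omega).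
have d0 : 0 < expR (- t * omega) + omega * x.
  by rewrite ltr_wpDr ?expR_gt0// !mulr_ge0 ?phi_ge0// ltW.
(* With this quotient as [eps], the regularised bound exceeds the desired one by exactly [e]. *)
have e'0 := divr_gt0 e0 d0.
apply: le_trans (energy_bound_eps A _ _ _ _ _ _ omega0 t0 e'0 coercive E0 Ec Ed Er) _.
rewrite -/x le_eqVlt; apply/orP; left; apply/eqP.
by field; rewrite gt_eqF.
Qed.

(** The set [D] is left free to cover both uses: [[0, t]] for the approximate solvers and [[0, +oo[]
    for the exact solution. *)
Lemma ivp_residual_bound {n : nat} (A : 'M[R]_n) (omega rho t : R)
    (D : set R) (b : 'cV[R]_n) (y : R -> 'cV[R]_n) :
  0 <= omega -> 0 <= t ->
  (forall x, omega * dot x x <= dot (A *m x) x) ->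
  `[0, t] `<=` D ->
  (forall s, D s -> derivable_within D y s) ->
  y 0 = 0 ->
  (forall s, 0 <= s <= t -> norm2 (- (A *m y s) - derive_within D y s + b) <= rho) ->
  norm2 (t *: (phi_mx (- t *: A) *m b) - y t) <= t * phi (- t * omega) * rho.
Proof.
move=> omega0; rewrite le_eqVlt => /predU1P[<-|t0] coercive tD dy y0 yr.
  by rewrite scale0r y0 subrr norm20 !mul0r.
(* The differential equation of [s phi(s M)] at [M = - A] reads [w' = b - A w]. *)
pose w s : 'cV[R]_n := s *: (phi_mx (s *: - A) *m b).
have dw s i : is_derive s (1 : R) (fun u => w u i 0) ((b - A *m w s) i 0).
  rewrite (_ : (fun _ => _) =
      \sum_(j < n) b j 0 \*: (fun u => u * phi_mx (u *: - A) i j)).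
    have dphi j := is_derive_phi_mx (- A) i j s.
    apply: is_derive_eq.
    rewrite (_ : b - A *m w s = (1%:M + s *: (- A *m phi_mx (s *: - A))) *m b).
      by rewrite [RHS]mxE; apply: eq_bigr => j _; rewrite mulrC.
    by rewrite mulmxDl mul1mx -scalemxAl mulNmx mulNmx scalerN -mulmxA scalemxAr.
  apply/funext => u; rewrite fct_sumE !mxE mulr_sumr; apply: eq_bigr => j _.
  by rewrite -[RHS]/(b j 0 * (u * phi_mx (u *: - A) i j)); ring.
have -> : t *: (phi_mx (- t *: A) *m b) = w t.
  by rewrite /w scalerN scaleNr.
apply: (energy_bound A omega rho t (fun s => w s - y s)
  (fun s => b - A *m w s - derive_within D y s)) => //.
- by rewrite /w scale0r y0 subrr.
- move=> i.
  have cw : {within `[0, t], continuous (fun u => w u i 0)}.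
    apply: continuous_subspaceT => u; apply: differentiable_continuous.
    by apply/derivable1_diffP; have [] := dw u i.
  have cy : {within `[0, t], continuous (fun u => y u i 0)}.
    apply: continuous_subspaceW tD _.
    exact: (continuous_within_coord D y i 0 dy).
  rewrite (_ : (fun _ => _) = (fun u => w u i 0 - y u i 0)); last first.
    by apply/funext => u; rewrite !mxE.
  by move=> s; apply: cvgB; [exact: cw|exact: cy].
- move=> s i /andP[s0 st].
  have Ds : nbhs s D.
    apply: filterS tD _; apply: filterS (@subset_itv_oo_cc _ _ 0 t) _.
    by apply: near_in_itvoo; rewrite in_itv/= s0.
  have dwi := dw s i.
  have dyi := derivable_within_is_derive D y s i 0 Ds (dy s (nbhs_singleton Ds)).
  rewrite (_ : (fun _ => _) = (fun u => w u i 0) - (fun u => y u i 0)); last first.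
    by apply/funext => u; rewrite -[RHS]/(w u i 0 - y u i 0) !mxE.
  by apply: is_derive_eq; rewrite [RHS]mxE; congr (_ + _); rewrite [RHS]mxE.
(* The terms in [w] cancel, and [E' + A E] is the residual of [y]. *)
- move=> s /andP[s0 st].
  rewrite (_ : _ + _ = - (A *m y s) - derive_within D y s + b).
    by apply: yr; rewrite !ltW.
  rewrite mulmxBr; move: (A *m w s) (A *m y s) => X Y.
  by apply/matrixP => i j; rewrite !mxE; ring.
Qed.

End Energy.

(** * Coercivity, recursion over the grids and the final estimate *)

Lemma coercive_symmetric_part {R : realType} {n : nat} (A : 'M[R]_n) (omega : R) :
  (forall x : 'cV[R]_n, x != 0 ->
     dot ((2^-1 *: (A + A^T)) *m x) x / dot x x >= omega) ->
  forall x, omega * dot x x <= dot (A *m x) x.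
Proof.
move=> coercive x; have [->|x0] := eqVneq x 0.
  by rewrite mulmx0 /dot !big1 ?mulr0// => i _; rewrite mxE mul0r.
have d0 : 0 < dot x x by rewrite lt_neqAle dot_ge0 andbT eq_sym dot_eq0.
have := coercive x x0; rewrite ler_pdivlMr//.
(* [A] and its transpose have the same quadratic form. *)
rewrite -scalemxAl dotZl mulmxDl dotDl dot_trmx (dotC x).
lra.
Qed.

(** Here [m.+1] is the number of grids. The coarsest one contributes only [c], so the second sum has
    one term more than the first. *)
Lemma recursive_error_bound {R : realType} (m : nat) (e a q : nat -> R) (c : R) :
  (forall j, 0 <= q j) ->
  (forall j, (1 <= j < m.+1)%N -> e j <= a j + q j * e j.+1 + c) ->
  e m.+1 <= c ->
  e 1%N <= \sum_(1 <= j < m.+1) (\prod_(1 <= i < j) q i) * a j +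
    c * \sum_(1 <= j < m.+2) \prod_(1 <= i < j) q i.
Proof.
move=> q0 rec em.
have prod0 k : 0 <= \prod_(1 <= i < k) q i by apply: prodr_ge0.
have step k : (k <= m)%N ->
    e 1%N <= \sum_(1 <= j < k.+1) (\prod_(1 <= i < j) q i) * a j +
      c * (\sum_(1 <= j < k.+1) \prod_(1 <= i < j) q i) +
      (\prod_(1 <= i < k.+1) q i) * e k.+1.
  elim: k => [|k IH] km; first by rewrite !big_geq// mulr0 !add0r mul1r.
  apply: le_trans (IH (ltnW km)) _.
  rewrite !(big_nat_recr k.+1)//=.
  have := ler_wpM2l (prod0 k.+1) (rec k.+1 km); lra.
apply: le_trans (step m (leqnn m)) _.
rewrite [in leRHS](big_nat_recr m.+1)//=.
have := ler_wpM2l (prod0 m.+1) em; lra.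
Qed.

Theorem proposition3p2 (R : realType) (m : nat) (n : nat -> nat)
    (A : forall j, 'M[R]_(n j)) (Q : forall j, 'M[R]_(n j, n j.+1))
    (omega : nat -> R) (v g : 'cV[R]_(n 1%N)) (yex : R -> 'cV[R]_(n 1%N))
    (tol t : R)
    (gtilde ghat : forall j, 'cV[R]_(n j))
    (ytilde : R -> 'cV[R]_(n m)) (yhat : forall j, R -> 'cV[R]_(n j))
    (ymgj : forall j, 'cV[R]_(n j)) (ymg : 'cV[R]_(n 1%N)) :
  (2 <= m)%N ->
  (forall j, (1 <= j < m)%N -> (n j.+1 < n j)%N) ->
  (forall j, (1 <= j <= m)%N -> 0 <= omega j) ->
  (forall j, (1 <= j <= m)%N -> forall x : 'cV[R]_(n j), x != 0 ->
     dot ((2^-1 *: (A j + (A j)^T)) *m x) x / dot x x >= omega j) ->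
  ~ (v = 0 /\ g = 0) ->
  solves_ivp (A 1%N) v g yex ->
  0 < tol ->
  0 <= t ->
  coarse_grid_correction A Q v g t gtilde ghat ytilde yhat ymgj ymg ->
  let omegabar := \big[Num.min/omega 1%N]_(1 <= j < m.+1) omega j in
  let beta := norm2 (g - A 1%N *m v) in
  (forall s : R, 0 <= s <= t ->
     norm2 (residual t (A m) (gtilde m) ytilde s) <= beta * tol) ->
  (forall j, (1 <= j < m)%N -> forall s : R, 0 <= s <= t ->
     norm2 (residual t (A j) (ghat j) (yhat j) s) <= beta * tol) ->
  norm2 (yex t - ymg) <=
    \sum_(1 <= j < m)
       (\prod_(1 <= i < j) opnorm2 (Q i)) * t *
       norm2 ((phi_mx (- t *: A j) *m Q j - Q j *m phi_mx (- t *: A j.+1))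
              *m gtilde j.+1)
    + t * phi (- t * omegabar) * beta * tol *
      \sum_(1 <= j < m.+1) \prod_(1 <= i < j) opnorm2 (Q i).
Proof.
move=> m2 _ omega_ge0 coercive _ [yex0 yexP] _ t0 cgc omegabar beta rm rj.
case: cgc => gt1 gtS ghatE ytC1 yt0 yhC1 yh0 ymgm ymgjE ymgE.
(* The starting value [omega 1] of the iterated minimum also belongs to the range, since
   [1 <= m]. *)
have omegabar0 : 0 <= omegabar.
  rewrite /omegabar big_nat_cond; elim/big_ind: _ => [|x y x0 y0|j].
  - by apply: omega_ge0; rewrite leqnn ltnW.
  - by rewrite le_min x0.
  - by rewrite andbT ltnS => /omega_ge0.
have {coercive} coercive j (j1m : (1 <= j <= m)%N) (x : 'cV[R]_(n j)) :
    omegabar * dot x x <= dot (A j *m x) x.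
  apply: le_trans (coercive_symmetric_part _ _ (coercive j j1m) x).
  rewrite ler_wpM2r ?dot_ge0//.
  by apply: ge_bigmin_seq; rewrite // mem_index_iota ltnS.
pose w j := t *: (phi_mx (- t *: A j) *m gtilde j).
pose e j := norm2 (w j - ymgj j).
pose a j := t * norm2 ((phi_mx (- t *: A j) *m Q j - Q j *m phi_mx (- t *: A j.+1))
              *m gtilde j.+1).
pose c := t * phi (- t * omegabar) * (beta * tol).
have Em : e m <= c.
  rewrite /e /w ymgm.
  apply: (ivp_residual_bound _ _ _ _ `[0, t]) => //.
  - by apply: coercive; rewrite leqnn ltnW.
  - by case: ytC1.
have Ej j : (1 <= j < m)%N -> e j <= a j + opnorm2 (Q j) * e j.+1 + c.
  move=> j1m.
  have errj : norm2 (t *: (phi_mx (- t *: A j) *m ghat j) - yhat j t) <= c.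
    apply: (ivp_residual_bound _ _ _ _ `[0, t]) => //.
    - by apply: coercive; case/andP: j1m => -> /ltnW.
    - by case: (yhC1 j j1m).
    - exact: yh0.
    - exact: rj.
  (* Split [gtilde j] as [ghat j + Q j gtilde j.+1], then add and subtract
     [t Q_j phi(-t A_(j+1)) gtilde_(j+1)]. *)
  have -> : e j = norm2 (t *: ((phi_mx (- t *: A j) *m Q j -
      Q j *m phi_mx (- t *: A j.+1)) *m gtilde j.+1) + Q j *m (w j.+1 - ymgj j.+1) +
      (t *: (phi_mx (- t *: A j) *m ghat j) - yhat j t)).
    rewrite /e /w ymgjE// ghatE// !mulmxBr mulmxBl -!scalemxAr !mulmxA.
    congr norm2; move: (_ *m gtilde j) (yhat j t) (Q j *m ymgj _)
      (_ *m Q j *m _) (Q j *m phi_mx _ *m _) => x1 x2 x3 x4 x5.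
    by apply/matrixP => i k; rewrite !mxE; ring.
  rewrite (le_trans (norm2D _ _))// lerD// (le_trans (norm2D _ _))//.
  by rewrite lerD ?opnorm2P// norm2Z ger0_norm.
have -> : norm2 (yex t - ymg) = e 1%N.
  congr norm2; rewrite ymgE opprD addrA; congr (_ - _).
  have dqE s : diff_quot (fun u => yex u - v) s = diff_quot yex s.
    by apply/funext => u; rewrite /diff_quot opprB addrA subrK.
  (* [yex - v] starts at 0 and has zero residual for the source [g - A v], so the bound with
     [rho = 0] forces equality with [w 1]. *)
  have : norm2 (w 1%N - (yex t - v)) <= t * phi (- t * omegabar) * 0.
    apply: (ivp_residual_bound _ _ _ _ `[0, +oo[ _ (fun u => yex u - v)) => //.
    - by apply: coercive; rewrite leqnn ltnW.
    - by move=> s; rewrite /= !in_itv/= andbT => /andP[].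
    - move=> s; rewrite /= in_itv/= andbT => s0.
      by rewrite /derivable_within dqE; case: (yexP s s0).
    - by rewrite yex0 subrr.
    - move=> s /andP[s0 _]; rewrite /derive_within dqE -/(derive_within _ _ _).
      have [_ ->] := yexP s s0; rewrite gt1 mulmxBr.
      rewrite (_ : _ + _ = 0) ?norm20//.
      by move: (_ *m _) (_ *m _) => x1 x2; apply/matrixP => i k; rewrite !mxE; ring.
  rewrite mulr0 => w0; apply/esym/eqP.
  by rewrite -subr_eq0 -norm2_eq0 eq_le w0 norm2_ge0.
have [k mE] : exists k, m = k.+1 by exists m.-1; rewrite prednK// ltnW.
have := @recursive_error_bound _ k e a (fun j => opnorm2 (Q j)) c.
rewrite -mE => /(_ (fun=> opnorm2_ge0 _) Ej Em) /le_trans; apply.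
rewrite lerD//.
  by apply: ler_sum => j _; rewrite mulrA.
by rewrite /c mulrA.
Qed.
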